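(* Let $q\ge4$ be a prime power of characteristic $p$, $A=\mathbb{F}_q[T]$. Let $\mathcal{W}^2=\{(g_1,g_2)\in A^2:g_2\neq0\}$ and let $\mathcal{S}^2\subseteq\mathcal{W}^2$ be the set of $\vec g=(g_1,g_2)$ such that $\nu_{(T)}(g_i)=0$ for $i=1,2$, and there exists a nonzero prime ideal $\mathfrak{l}\neq(T)$ of $A$ with $\nu_{\mathfrak{l}}(g_1)=0$ and $p\nmid\nu_{\mathfrak{l}}(g_2)$. Then the density of $\mathcal{S}^2$ exists and equals $\left(1-\frac1q\right)^2$.
   Context: $\nu_{\mathfrak{l}}$ is the normalized $\mathfrak{l}$-adic valuation. For $g\in A$ let $|g|=q^{\deg_T g}$ if $g\neq0$ and $|0|=0$; for $\vec g\in A^r$ let $|\vec g|=\max_i|g_i|$. For $N>0$ let $\mathcal{W}^r(N)=\{\vec g\in\mathcal{W}^r:|\vec g|<q^N\}$ and for $\mathcal{S}\subseteq\mathcal{W}^r$ let $\mathcal{S}(N)=\mathcal{S}\cap\mathcal{W}^r(N)$. The density of $\mathcal{S}$ is $\lim_{N\to\infty}|\mathcal{S}(N)|/|\mathcal{W}^r(N)|$ when the limit exists. *)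

(* Defs.v *)
From HB Require Import structures.
From mathcomp Require Import all_boot all_order all_algebra ring_quotient.
From mathcomp Require Import finmap.
From mathcomp Require Import boolp classical_sets functions cardinality.
From mathcomp Require Import reals topology normedtype sequences.

Set Implicit Arguments.
Unset Strict Implicit.
Unset Printing Implicit Defensive.

Import Order.TTheory GRing.Theory Num.Theory.
Import numFieldNormedType.Exports.

Local Open Scope classical_set_scope.
Local Open Scope ring_scope.

Section Ideals.
Variable A : comNzRingType.
Implicit Types (I J : set A) (g : A).

Definition principal_ideal g : set A := [set g * h | h in [set: A]].

(* [idealr_closed] already includes properness (1 is not in the ideal). *)
Definition prime_ideal I : Prop :=
  idealr_closed [in I] /\ prime_idealr_closed [in I].

Definition ideal_mul I J : set A :=
  [set x | exists2 s : seq (A * A),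
    (forall u, u \in s -> I u.1 /\ J u.2) & x = \sum_(u <- s) u.1 * u.2].

Fixpoint ideal_exp I (n : nat) : set A :=
  if n is m.+1 then ideal_mul I (ideal_exp I m) else [set: A].

(* The normalized I-adic valuation of g for a nonzero prime ideal I: the
   exponent n such that g lies in I^n but not in I^(n+1). [None] stands for
   +oo, which is the valuation of 0. *)
Definition ideal_val I g : option nat :=
  xget None
    [set o | exists2 n, o = Some n & ideal_exp I n g /\ ~ ideal_exp I n.+1 g].

End Ideals.

Section Density.
Variable F : finFieldType.
Local Notation A := {poly F}.
Implicit Types (g : A) (v : A * A) (S : set (A * A)) (N p : nat).

Definition absA g : nat := if g == 0 then 0%N else (#|F| ^ (size g).-1)%N.

Definition absA2 v : nat := maxn (absA v.1) (absA v.2).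

Definition W2 : set (A * A) := [set v | v.2 != 0].

Definition W2_below N : set (A * A) :=
  [set v | W2 v /\ (absA2 v < #|F| ^ N)%N].

Definition below S N : set (A * A) := S `&` W2_below N.

Definition S2 p : set (A * A) :=
  [set v | [/\ W2 v,
               ideal_val (principal_ideal 'X) v.1 = Some 0%N,
               ideal_val (principal_ideal 'X) v.2 = Some 0%N &
               exists l : set A,
                 [/\ prime_ideal l, l <> [set 0], l <> principal_ideal 'X,
                     ideal_val l v.1 = Some 0%N &
                     exists2 n, ideal_val l v.2 = Some n & ~~ (p %| n)%N]]].

(* [fset_set] returns the empty set on infinite sets; [finite_W2_below] shows
   that this default never occurs in [has_density]. *)
Lemma finite_W2_below N : finite_set (W2_below N).
Proof.
have sz g : (absA g < #|F| ^ N)%N -> (size g <= N)%N.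
  rewrite /absA; case: eqP => [->|/eqP g0]; first by rewrite size_poly0.
  rewrite ltn_exp2l; last exact: card_finNzRing_gt1.
  by rewrite prednK // size_poly_gt0.
pose f (u : 'rV[F]_N * 'rV[F]_N) : A * A := (rVpoly u.1, rVpoly u.2).
apply: (@sub_finite_set _ _ (f @` [set: 'rV[F]_N * 'rV[F]_N])).
  move=> [g h] [_]; rewrite /absA2 /= gtn_max => /andP[/sz gN /sz hN].
  by exists (poly_rV g, poly_rV h) => //; rewrite /f /= !poly_rV_K.
exact/finite_image/finite_finset.
Qed.

Definition has_density (R : realType) S (d : R) : Prop :=
  (#|` fset_set (below S N)|%:R / #|` fset_set (W2_below N)|%:R : R)
    @[N --> \oo] --> d.

End Density.

Arguments S2 F p : clear implicits.

(* Main.v *)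
Require Import Defs.
From mathcomp Require Import all_boot all_order all_algebra separable.
From mathcomp Require Import finmap zify ring.
From mathcomp Require Import boolp classical_sets cardinality.
From mathcomp Require Import reals topology normedtype sequences.

(** Pairs with both entries prime to [T] have density [(1 - 1/q)^2], so it is
    enough that those lying outside [S2] have density 0. Let [w / h] be the
    logarithmic derivative [g2' / g2] in lowest terms: [h] is squarefree and
    all its prime divisors [l] satisfy [~~ (p %| v_l(g2))], so [h] divides
    [g1] when the pair is not in [S2]. If [deg h >= D] this leaves a proportion
    at most [q^(- D)] of the possible [g1]. On the other hand [w / h] determines
    [g2] up to a factor in [F(T^p)], so at most [q^(2 D + N/p + 1)] of the
    [q^N] polynomials [g2] have [deg h < D]. Taking [D = N/6] makes both
    contributions negligible. *)

Set Implicit Arguments.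
Unset Strict Implicit.
Unset Printing Implicit Defensive.

Import Order.TTheory GRing.Theory Num.Theory.
Import numFieldNormedType.Exports.

Local Open Scope ring_scope.

Lemma leq_card_fibers (T U : finType) (f : T -> U) (A : {set T}) m :
  (forall u, #|[set x in A | f x == u]| <= m)%N -> (#|A| <= #|U| * m)%N.
Proof.
move=> fiber_le; rewrite -sum1_card (partition_big f predT) //= -sum_nat_const.
by apply: leq_sum => u _; rewrite sum1dep_card fiber_le.
Qed.

Lemma eqn_mod_pchar (R : nzRingType) p m n : p \in [pchar R] ->
  (m == n %[mod p]) = (m%:R == n%:R :> R).
Proof.
move=> pcharRp; wlog nm : m n / (n <= m)%N => [eqn_mod|].
  have [/eqn_mod//|/ltnW/eqn_mod] := leqP n m.
  by rewrite eq_sym => ->; rewrite eq_sym.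
by rewrite eqn_mod_dvd // (dvdn_pcharf pcharRp) natrB // subr_eq0.
Qed.

Lemma coefM_top (R : nzSemiRingType) (f g : {poly R}) m n :
  (size f <= m.+1)%N -> (size g <= n.+1)%N -> (f * g)`_(m + n) = f`_m * g`_n.
Proof.
move=> fm gn; have mP : (m < (m + n).+1)%N by rewrite ltnS leq_addr.
rewrite coefM (bigD1 (Ordinal mP)) //= addKn big1 ?addr0 // => i.
rewrite -val_eqE neq_ltn /= => /orP[im|mi].
  by rewrite [g`__]nth_default ?mulr0 // (leq_trans gn) //; lia.
by rewrite [f`__]nth_default ?mul0r // (leq_trans fm).
Qed.

Lemma coefX_deriv (R : nzSemiRingType) (g : {poly R}) n :
  ('X * g^`())`_n = g`_n *+ n.
Proof. by rewrite coefXM; case: n => [|n] //=; rewrite coef_deriv. Qed.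

Lemma leq_size_mull (R : idomainType) (f g : {poly R}) n : f != 0 ->
  (size (f * g)%R <= n)%N = (size g <= n - (size f).-1)%N.
Proof.
move=> f0; have [->|g0] := eqVneq g 0; first by rewrite mulr0 size_poly0.
by rewrite size_mul //; move: f0 g0; rewrite -!size_poly_gt0; lia.
Qed.

Section IrreducibleDivisors.
Variable K : fieldType.
Implicit Types (g h l : {poly K}).

Lemma irreducible_dvdp_exists g : (1 < size g)%N ->
  exists2 l, irreducible_poly l & l %| g.
Proof.
move=> g_gt1; pose has_divisor n := `[< exists2 l, l %| g & size l = n.+2 >].
have : exists n, has_divisor n.
  exists (size g).-2; apply/asboolP; exists g => //.
  by case: size g_gt1 => [|[]].
case/ex_minnP=> n /asboolP[l lg szl] n_min.
exists l => //; split=> [|d d_neq1 dl]; first by rewrite szl.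
have l0 : l != 0 by rewrite -size_poly_eq0 szl.
rewrite -dvdp_size_eqp // eqn_leq dvdp_leq //= szl.
have d0 : d != 0 by apply: contraTneq dl => ->; rewrite dvd0p.
have [m szd] : exists m, size d = m.+2.
  move: d0 d_neq1; rewrite -size_poly_eq0.
  by case: size => [|[|m]] //; exists m.
rewrite szd !ltnS; apply: n_min; apply/asboolP; exists d => //.
exact: dvdp_trans lg.
Qed.

Lemma irreducible_dvdpM l g h : irreducible_poly l ->
  (l %| g * h) = (l %| g) || (l %| h).
Proof.
move=> irr; have [lg|] := boolP (l %| g); first exact: dvdp_mulr.
by rewrite -irreducible_poly_coprime // => co; rewrite Gauss_dvdpr.
Qed.

Lemma separable_dvdp h g : separable_poly h ->
  (forall l, irreducible_poly l -> l %| h -> l %| g) -> h %| g.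
Proof.
move=> sep_h dvd_g; set d := gcdp h g; set e := h %/ d.
have hE : h = e * d by rewrite divpK // dvdp_gcdl.
have co : coprimep e d by apply: (separable_coprime sep_h); rewrite -hE.
have [e_le1|e_gt1] := leqP (size e) 1.
  have e0 : e != 0.
    apply: contraTneq (separable_poly_neq0 sep_h) => e0.
    by rewrite hE e0 mul0r negbK.
  have /size_poly1P[c c0 eE] : size e == 1%N.
    by rewrite eqn_leq e_le1 size_poly_gt0.
  by rewrite hE eE mul_polyC dvdpZl // dvdp_gcdr.
have [l irr le] := irreducible_dvdp_exists e_gt1.
have lh : l %| h by rewrite hE dvdp_mulr.
have ld : l %| d by rewrite dvdp_gcd lh dvd_g.
have [l_gt1 _] := irr.
by move/coprimepP: co => /(_ l le ld); rewrite -size_poly_eq1 gtn_eqF.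
Qed.

End IrreducibleDivisors.

Section ExactDivision.
Variable K : fieldType.
Implicit Types (g l : {poly K}) (m n : nat).

Definition exact_dvdp l n g := (l ^+ n %| g) && ~~ (l ^+ n.+1 %| g).

Lemma exact_dvdp_inj l g m n : exact_dvdp l m g -> exact_dvdp l n g -> m = n.
Proof.
move=> /andP[lm ndvd_lmS] /andP[ln ndvd_lnS]; case: (ltngtP m n) => // [mn|nm].
- by case/negP: ndvd_lmS; apply: dvdp_trans ln; exact: dvdp_exp2l.
- by case/negP: ndvd_lnS; apply: dvdp_trans lm; exact: dvdp_exp2l.
Qed.

Lemma exact_dvdp0 l g : exact_dvdp l 0 g = ~~ (l %| g).
Proof. by rewrite /exact_dvdp expr0 dvd1p expr1. Qed.

Lemma exact_dvdp_exists l g : (1 < size l)%N -> g != 0 ->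
  exists n, exact_dvdp l n g.
Proof.
move=> l_gt1 g0; have dvd_bound n : l ^+ n %| g -> (n <= size g)%N.
  move=> /dvdp_leq -/(_ g0); apply: leq_trans; apply: leq_trans (leq_pred _).
  by rewrite size_exp leq_pmull // -ltnS prednK // ltnW.
have dvd_some : exists n, l ^+ n %| g by exists 0%N; rewrite expr0 dvd1p.
case: (ex_maxnP dvd_some dvd_bound) => n ln n_max.
by exists n; rewrite /exact_dvdp ln; apply/negP => /n_max; rewrite ltnn.
Qed.

End ExactDivision.

Section LogarithmicDerivative.
Variables (K : fieldType) (p : nat).
Hypothesis pcharKp : p \in [pchar K].
Implicit Types (f g h l : {poly K}) (n : nat).

Definition logder_num g := g^`() %/ gcdp g g^`().
Definition logder_den g := g %/ gcdp g g^`().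

Lemma logder_denK g : logder_den g * gcdp g g^`() = g.
Proof. by rewrite divpK // dvdp_gcdl. Qed.

Lemma logder_den_neq0 g : g != 0 -> logder_den g != 0.
Proof. by apply: contraNneq => den0; rewrite -[g]logder_denK den0 mul0r. Qed.

Lemma logder_cross g : logder_den g * g^`() = logder_num g * g.
Proof.
have numK : logder_num g * gcdp g g^`() = g^`() by rewrite divpK // dvdp_gcdr.
by rewrite -[in LHS]numK -[X in _ = _ * X]logder_denK mulrCA.
Qed.

Lemma leq_size_logder g : (size (logder_num g) <= size (logder_den g))%N.
Proof.
have [->|g0] := eqVneq g 0.
  by rewrite /logder_num deriv0 div0p size_poly0.
have gcd0 : gcdp g g^`() != 0 by rewrite gcdp_eq0 negb_and g0.
by rewrite !size_divp // leq_sub2r // ltnW // lt_size_deriv.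
Qed.

Lemma deriv_exprM_dvdn l n g : (p %| n)%N ->
  (l ^+ n * g)^`() = l ^+ n * g^`().
Proof.
case/dvdnP=> m ->; have pcharKXp : p \in [pchar {poly K}] by rewrite pchar_poly.
by rewrite derivM deriv_exp mulrnA mulrn_pchar // mul0r add0r.
Qed.

Lemma logder_den_exact_dvdp l n g :
  l %| logder_den g -> exact_dvdp l n g -> ~~ (p %| n)%N.
Proof.
move=> l_den /andP[/dvdpP[c gE] ndvd]; apply/negP => pn.
rewrite mulrC in gE; have ln0 : l ^+ n != 0.
  by apply: contraNneq ndvd => ln0; rewrite gE ln0 mul0r dvdp0.
have /dvdpP[d gcdE] : l ^+ n %| gcdp g g^`().
  by rewrite dvdp_gcd gE deriv_exprM_dvdn // !dvdp_mulr.
have cE : c = logder_den g * d.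
  apply: (mulfI ln0).
  by rewrite -gE mulrCA [l ^+ n * d]mulrC -gcdE logder_denK.
by case/negP: ndvd; rewrite gE exprSr dvdp_mul2l // cE dvdp_mulr.
Qed.

Lemma logder_den_dvdp g f : g != 0 ->
  (forall l n, irreducible_poly l -> exact_dvdp l n g -> ~~ (p %| n)%N ->
     l %| f) ->
  logder_den g %| f.
Proof.
move=> g0 dvd_f; apply: separable_dvdp (make_separable g0) _ => l irr l_den.
have [l_gt1 _] := irr; have [n ln] := exact_dvdp_exists l_gt1 g0.
exact: dvd_f irr ln (logder_den_exact_dvdp l_den ln).
Qed.

(* The coefficient of ['X * (f' g - f g')] at [deg f + deg g] is
   [(deg f - deg g) * lead_coef f * lead_coef g]. *)
Lemma wronskian0_deg_modp f g : f != 0 -> g != 0 ->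
  f^`() * g = f * g^`() -> (size f).-1 = (size g).-1 %[mod p].
Proof.
move=> + + /(congr1 ( *%R 'X)); rewrite mulrA mulrCA.
rewrite -!lead_coef_eq0 !lead_coefE; set m := (size f).-1; set n := (size g).-1.
move=> fm0 gn0 /(congr1 (coefp (m + n))) /=.
have szX h : (size ('X * h^`())%R <= (size h).-1.+1)%N.
  have [->|h0] := eqVneq h 0; first by rewrite deriv0 mulr0 size_poly0.
  rewrite (leq_trans (size_polyMleq _ _)) // size_polyX /=.
  by rewrite (leq_trans (lt_size_deriv h0)) ?leqSpred.
rewrite !coefM_top ?szX ?leqSpred // !coefX_deriv.
rewrite -mulr_natr -[g`_n *+ n]mulr_natr mulrAC mulrA.
move/(mulfI (mulf_neq0 fm0 gn0)) => eq_mn.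
by apply/eqP; rewrite (eqn_mod_pchar _ _ pcharKp) eq_mn.
Qed.

End LogarithmicDerivative.

Section IdealValuation.
Variable K : fieldType.
Implicit Types (g h l : {poly K}) (n : nat).

Lemma principal_idealP l g : principal_ideal l g <-> l %| g.
Proof.
split=> [[h _ <-]|/dvdpP[h ->]]; first exact: dvdp_mulr.
by exists h => //; rewrite mulrC.
Qed.

Lemma ideal_exp_principalP l n g :
  ideal_exp (principal_ideal l) n g <-> l ^+ n %| g.
Proof.
elim: n g => [|n IHn] g /=; first by rewrite expr0 dvd1p.
split=> [[s sP ->]|/dvdpP[h ->]].
  rewrite big_seq; apply: (big_ind (fun x => l ^+ n.+1 %| x)) => [|x y|].
  - exact: dvdp0.
  - exact: dvdp_add.
  - by move=> u /sP[/principal_idealP lu /IHn lnu]; rewrite exprS dvdp_mul.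
exists [:: (l, l ^+ n * h)]; last by rewrite big_seq1 /= mulrA -exprS mulrC.
move=> u; rewrite inE => /eqP -> /=; split; first exact/principal_idealP.
by apply/IHn; rewrite dvdp_mulr.
Qed.

Lemma ideal_val_principalP l g n :
  ideal_val (principal_ideal l) g = Some n <-> exact_dvdp l n g.
Proof.
have exactP k : (ideal_exp (principal_ideal l) k g /\
    ~ ideal_exp (principal_ideal l) k.+1 g) <-> exact_dvdp l k g.
  rewrite /exact_dvdp; split.
    move=> [/ideal_exp_principalP lk ndvd]; rewrite lk.
    by apply/negP => /ideal_exp_principalP.
  move=> /andP[lk /negP ndvd]; split; first exact/ideal_exp_principalP.
  by apply: contra_not ndvd => /ideal_exp_principalP.
rewrite /ideal_val; split=> [|ln].
  by case: xgetP => [_ _ [k -> /exactP lk] [<-]|//].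
apply: xget_unique => [|_ [k -> /exactP lk]].
  by exists n => //; exact/exactP.
by rewrite (exact_dvdp_inj lk ln).
Qed.

Lemma prime_principal_ideal l : irreducible_poly l ->
  prime_ideal (principal_ideal l).
Proof.
move=> irr; have [l_gt1 _] := irr.
have inE' g : (g \in [in principal_ideal l]) = (l %| g).
  by apply/idP/idP; rewrite !inE /= => /principal_idealP.
split; last by move=> g h; rewrite !inE' irreducible_dvdpM.
split; rewrite ?inE' ?dvdp0 ?dvdp1 ?gtn_eqF // => a g h.
by rewrite !inE' => lg lh; rewrite dvdp_add // dvdp_mull.
Qed.

End IdealValuation.

Section ExceptionalPairs.
Variables (F : finFieldType) (p : nat).
Implicit Types (l : {poly F}) (v : {poly F} * {poly F}).

Definition not_dvdp_pairs l : set ({poly F} * {poly F}) :=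
  [set v | ~~ (l %| v.1) /\ ~~ (l %| v.2)]%classic.

Definition logder_den_dvdp_pairs : set ({poly F} * {poly F}) :=
  [set v | logder_den v.2 %| v.1]%classic.

Lemma S2_sub_not_dvdp_pairs : (S2 F p `<=` not_dvdp_pairs 'X)%classic.
Proof.
move=> v [_ /ideal_val_principalP + /ideal_val_principalP].
by rewrite !exact_dvdp0.
Qed.

Lemma irreducible_mem_S2 l n v :
  not_dvdp_pairs 'X v -> irreducible_poly l ->
  ~~ (l %| v.1) -> exact_dvdp l n v.2 -> ~~ (p %| n)%N -> S2 F p v.
Proof.
move=> [Xv1 Xv2] irr lv1 ln pn; split.
- by apply: contraNneq Xv2 => ->; rewrite dvdp0.
- by apply/ideal_val_principalP; rewrite exact_dvdp0.
- by apply/ideal_val_principalP; rewrite exact_dvdp0.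
have ll : principal_ideal l l by exact/principal_idealP.
exists (principal_ideal l); split.
- exact: prime_principal_ideal.
- by move=> l0; move: ll (irredp_neq0 irr); rewrite l0 /= => ->; rewrite eqxx.
- move=> lX; case/negP: Xv2; move: ll; rewrite lX => /principal_idealP Xl.
  apply: dvdp_trans Xl (dvdp_trans _ (proj1 (andP ln))).
  by case: n pn {ln} => [|n _]; rewrite ?dvdn0 // exprS dvdp_mulr.
- by apply/ideal_val_principalP; rewrite exact_dvdp0.
- by exists n => //; exact/ideal_val_principalP.
Qed.

Lemma not_dvdp_pairs_sub : p \in [pchar F] ->
  (not_dvdp_pairs 'X `<=` S2 F p `|` logder_den_dvdp_pairs)%classic.
Proof.
move=> pcharFp v Xv; have v2_neq0 : v.2 != 0.
  by case: Xv => _; apply: contraNneq => ->; rewrite dvdp0.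
have [|notS2] := pselect (S2 F p v); [by left | right].
apply: (logder_den_dvdp pcharFp v2_neq0) => l n irr ln pn.
by apply: contra_notT notS2 => lv1; exact: irreducible_mem_S2 ln pn.
Qed.

End ExceptionalPairs.

Section Counting.
Variable F : finFieldType.
Local Notation q := #|F|.
Implicit Types (g h w : {poly F}) (D N : nat).

Lemma npoly_eq0 N (g : {poly_N F}) : (g == 0) = (g == 0 :> {poly F}).
Proof. by rewrite -val_eqE. Qed.

Lemma card_multiples_npoly N h : h != 0 ->
  #|[set g : {poly_N F} | h %| g]| = (q ^ (N - (size h).-1))%N.
Proof.
move=> h0; pose mulh (u : {poly_(N - (size h).-1) F}) := npolyp N (h * u).
have mulhE u : mulh u = h * u :> {poly F}.
  by rewrite npolypK // leq_size_mull // size_npoly.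
have mulh_inj : injective mulh.
  by move=> u v /(congr1 val); rewrite /= !mulhE => /(mulfI h0)/val_inj.
rewrite -card_npoly -(card_imset predT mulh_inj); apply: eq_card => g.
rewrite inE; apply/dvdpP/imsetP => [[u gE]|[u _ ->]]; last first.
  by exists (u : {poly F}); rewrite mulhE mulrC.
rewrite mulrC in gE; exists (npolyp _ u) => //; apply: val_inj.
by rewrite /= mulhE npolypK // -leq_size_mull // -gE size_npoly.
Qed.

Lemma card_not_dvdp_npoly N h : h != 0 ->
  #|[set g : {poly_N F} | ~~ (h %| g)]| = (q ^ N - q ^ (N - (size h).-1))%N.
Proof.
move=> h0; rewrite cardsCs card_npoly -(card_multiples_npoly N h0).
by congr subn; apply: eq_card => g; rewrite !inE negbK.
Qed.

Section LogderCounting.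
Variable p : nat.
Hypothesis pcharFp : p \in [pchar F].

(* Two members of the set differ by an element of degree congruent modulo [p]
   to that of any nonzero member, hence they are separated by the coefficients
   whose indices lie in this residue class. *)
Lemma card_logder_npoly N h w : h != 0 ->
  (#|[set g : {poly_N F} | (h * g^`() == w * g)%R]| <= q ^ (N %/ p).+1)%N.
Proof.
move=> h0; set sols := [set g | _].
have [sols0|[g0]] := set_0Vmem (sols :\ 0).
  rewrite (cardsD1 0) sols0 cards0 addn0 (leq_trans (leq_b1 _)) //.
  by rewrite expn_gt0 (ltnW (card_finNzRing_gt1 F)).
rewrite !inE npoly_eq0 => /andP[g0_neq0 /eqP g0_sol].
pose r := ((size g0).-1 %% p)%N.
pose residue_coefs (g : {poly_N F}) :=
  mk_npoly (N %/ p).+1 (fun i => g`_(i * p + r)).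
rewrite -card_npoly -(@card_in_imset _ _ residue_coefs) ?max_card // => f g.
rewrite !inE => /eqP f_sol /eqP g_sol fg_coefs.
apply/eqP; rewrite -subr_eq0 npoly_eq0; apply: contraT => d0.
set d : {poly F} := \val (f - g) in d0; have dE : d = \val f - \val g by [].
have deg_d : (size d).-1 = (size g0).-1 %[mod p].
  apply: (wronskian0_deg_modp pcharFp) => //; apply: (mulfI h0).
  rewrite mulrA dE derivB mulrBr f_sol g_sol -mulrBr -dE mulrAC -g0_sol.
  by ring.
have lead_d : d`_(size d).-1 = 0.
  pose i := ((size d).-1 %/ p)%N.
  move/(congr1 (fun u : {poly_(N %/ p).+1 F} => u`_i)): fg_coefs.
  rewrite !coef_poly ltnS leq_div2r; last first.
    by rewrite (leq_trans (leq_pred _)) // size_npoly.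
  by rewrite /r -deg_d -divn_eq dE coefB => ->; rewrite subrr.
by move: d0; rewrite -lead_coef_eq0 lead_coefE lead_d eqxx.
Qed.

Lemma card_small_logder_den N D :
  (#|[set g : {poly_N F} | (g != 0%R) && (size (logder_den g) <= D)]|
     <= q ^ (D + D) * q ^ (N %/ p).+1)%N.
Proof.
pose num_den (g : {poly_N F}) :=
  (npolyp D (logder_num g), npolyp D (logder_den g)).
rewrite expnD -card_npoly -card_prod; apply: (leq_card_fibers (f := num_den)).
case=> w h; set fiber := [set g in _ | _].
have fiberP (g : {poly_N F}) : g \in fiber ->
    [/\ g != 0, logder_num g = \val w & logder_den g = \val h].
  rewrite !inE => /andP[/andP[g0 le_den] /eqP[<- <-]].
  by rewrite /= !npolypK // (leq_trans (leq_size_logder g)).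
have [->|[g /fiberP[g0 _ denE]]] := set_0Vmem fiber; first by rewrite cards0.
have h0 : \val h != 0 by rewrite -denE logder_den_neq0 // -npoly_eq0.
apply: leq_trans (card_logder_npoly N w h0).
apply/subset_leq_card/fintype.subsetP => f /fiberP[_ <- <-].
by rewrite inE logder_cross.
Qed.

End LogderCounting.

Definition npoly_pairs (S : set ({poly F} * {poly F})) N :
    {set {poly_N F} * {poly_N F}} :=
  [set v : {poly_N F} * {poly_N F} |
     (v.2 != 0) && `[< S (\val v.1, \val v.2) >]].

Lemma npoly_pairs_sub S T N : (S `<=` T)%classic ->
  npoly_pairs S N \subset npoly_pairs T N.
Proof.
move=> ST; apply/fintype.subsetP => v; rewrite !inE => /andP[-> /asboolP Sv].
by apply/asboolP; exact: ST.
Qed.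

Lemma npoly_pairsU S T N :
  npoly_pairs (S `|` T)%classic N = npoly_pairs S N :|: npoly_pairs T N.
Proof. by apply/finset.setP => v; rewrite !inE asbool_or andb_orr. Qed.

Lemma absA_lt g N : (absA g < q ^ N)%N = (size g <= N)%N.
Proof.
have q_gt1 : (1 < q)%N by exact: card_finNzRing_gt1.
rewrite /absA; have [->|g0] := eqVneq g 0.
  by rewrite size_poly0 expn_gt0 (ltnW q_gt1).
by rewrite ltn_exp2l // prednK // size_poly_gt0.
Qed.

Lemma card_fset_set_below (S : set ({poly F} * {poly F})) N :
  #|` fset_set (below S N)| = #|npoly_pairs S N|.
Proof.
pose polyn2 (v : {poly_N F} * {poly_N F}) := (\val v.1, \val v.2).
have polyn2_inj : injective polyn2.
  by move=> [f g] [f' g'] [/val_inj-> /val_inj->].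
have -> : below S N = (polyn2 @` [set` npoly_pairs S N])%classic.
  apply/seteqP; split=> [[f g] [Sfg [/= g0]]|_ [[f g] + <-]].
    rewrite /absA2 gtn_max !absA_lt => /andP[/= fN gN].
    exists (npolyp N f, npolyp N g); last by rewrite /polyn2 /= !npolypK.
    by rewrite /= inE npoly_eq0 /= !npolypK // g0; apply/asboolP.
  rewrite /= inE => /andP[g0 /asboolP Sfg]; split=> //; split.
    by rewrite /W2 /= -npoly_eq0.
  by rewrite /= /absA2 gtn_max !absA_lt !size_npoly.
rewrite fset_set_image; last exact: finite_finpred.
rewrite card_imfset //= -[LHS]/(#|` fset_set [set` _]%classic|) -card_finset.
congr (size (enum_fset _)); apply/fsetP => v.
by rewrite in_fset_set ?mem_setE ?inE //; exact: finite_finpred.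
Qed.

Lemma card_npoly_pairsT N : #|npoly_pairs setT N| = (q ^ N * (q ^ N - 1))%N.
Proof.
have -> : npoly_pairs setT N = finset.setX [set: {poly_N F}] (~: [set 0]).
  by apply/finset.setP => v; rewrite !inE asboolT // andbT.
by rewrite cardsX cardsT cardsC1 card_npoly subn1.
Qed.

Lemma card_npoly_pairs_not_dvdp h N : h != 0 ->
  #|npoly_pairs (not_dvdp_pairs h) N| = ((q ^ N - q ^ (N - (size h).-1)) ^ 2)%N.
Proof.
move=> h0; rewrite -(card_not_dvdp_npoly N h0) -mulnn -cardsX.
apply: eq_card => v; rewrite !inE.
apply/andP/andP => [[_ /asboolP[]]|[hv1 hv2]] //; split; last exact/asboolP.
by rewrite npoly_eq0; apply: contraNneq hv2 => ->; rewrite dvdp0.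
Qed.

Lemma card_npoly_pairs_logder_den p N D : p \in [pchar F] ->
  (#|npoly_pairs (@logder_den_dvdp_pairs F) N|
     <= q ^ N * (q ^ (D + D) * q ^ (N %/ p).+1) + q ^ N * q ^ (N - D))%N.
Proof.
move=> pcharFp; set E := npoly_pairs _ N.
pose small := [set g : {poly_N F} | (g != 0) && (size (logder_den g) <= D)%N].
rewrite -(cardsID (finset.setX [set: {poly_N F}] small) E) leq_add //.
  apply: leq_trans (subset_leq_card (finset.subsetIr _ _)) _.
  by rewrite cardsX cardsT card_npoly leq_mul2l card_small_logder_den ?orbT.
rewrite -[X in (_ <= X * _)%N]card_npoly.
apply: (leq_card_fibers (f := snd)) => g.
set fiber := [set v in _ | _].
have fiberP v : v \in fiber ->
    [/\ v.2 = g, g != 0, logder_den g %| v.1 & (D < size (logder_den g))%N].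
  rewrite !inE => /andP[/andP[+ /andP[v0 /asboolP den]] /eqP vg].
  by rewrite v0 -ltnNge -vg.
have [->|[v /fiberP[_ g0 _ big]]] := set_0Vmem fiber; first by rewrite cards0.
have den0 : logder_den g != 0 by rewrite logder_den_neq0 // -npoly_eq0.
apply: (@leq_trans (q ^ (N - (size (logder_den g)).-1))%N); last first.
  rewrite leq_exp2l ?card_finNzRing_gt1 // leq_sub2l //.
  by rewrite -ltnS (leq_trans big) ?leqSpred.
rewrite -(card_multiples_npoly N den0).
rewrite -[X in (_ <= X)%N]muln1 -(cards1 g) -cardsX.
apply/subset_leq_card/fintype.subsetP => u /fiberP[ug _ den _].
by rewrite !inE den ug eqxx.
Qed.

End Counting.

Section Densities.
Local Open Scope classical_set_scope.
Variables (R : realType) (F : finFieldType).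
Local Notation q := #|F|.
Local Notation pairs := ({poly F} * {poly F})%type.
Implicit Types (S T E : set pairs) (N : nat) (d : R).

Definition npoly_ratio S N : R :=
  #|npoly_pairs S N|%:R / #|npoly_pairs [set: pairs] N|%:R.

Lemma has_densityE S d : has_density S d = (npoly_ratio S N @[N --> \oo] --> d).
Proof.
rewrite /has_density; congr (cvg_to (fmap _ \oo) _); apply/funext => N.
rewrite /npoly_ratio card_fset_set_below; congr (_ / _%:R).
by rewrite -card_fset_set_below /below setTI.
Qed.

Lemma has_density_diff_null S T E d : S `<=` T -> T `<=` S `|` E ->
  has_density T d -> has_density E (0 : R) -> has_density S d.
Proof.
rewrite !has_densityE => ST TSE densT densE.
have diff_cvg : npoly_ratio T N - npoly_ratio E N @[N --> \oo] --> d.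
  by rewrite -[d]subr0; exact: cvgB densT densE.
apply: squeeze_cvgr diff_cvg densT; apply: nearW => N.
rewrite /npoly_ratio -mulrBl !ler_wpM2r ?invr_ge0 ?ler0n //.
  by rewrite ler_nat subset_leq_card // npoly_pairs_sub.
rewrite lerBlDr -natrD ler_nat.
apply: leq_trans (subset_leq_card (npoly_pairs_sub N TSE)) _.
by rewrite npoly_pairsU -cardsUI leq_addr.
Qed.

Let q_gt0 : (0 < q)%N.
Proof. exact: ltnW (card_finNzRing_gt1 F). Qed.

Let qR_neq0 : (q%:R : R) != 0.
Proof. by rewrite pnatr_eq0 -lt0n. Qed.

Let cvg_qVn : (q%:R ^- N : R) @[N --> \oo] --> (0 : R).
Proof.
under eq_fun do rewrite -exprVn.
apply: cvg_expr; rewrite ger0_norm ?invr_ge0 ?ler0n // invf_lt1 ?ltr0n //.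
by rewrite ltr1n card_finNzRing_gt1.
Qed.

Lemma cvg_has_density S d :
  #|npoly_pairs S N|%:R / (q%:R ^+ N) ^+ 2 @[N --> \oo] --> d ->
  has_density S d.
Proof.
rewrite has_densityE => dens.
have ratioE N : npoly_ratio S N =
    #|npoly_pairs S N|%:R / (q%:R ^+ N) ^+ 2 / (1 - q%:R ^- N).
  have qN_neq0 : (q%:R : R) ^+ N != 0 by rewrite expf_neq0.
  rewrite /npoly_ratio card_npoly_pairsT natrM natrB ?expn_gt0 ?q_gt0 //.
  by rewrite natrX -mulrA -invfM; congr (_ / _); field.
rewrite (funext ratioE) -[d]mulr1; apply: cvgM => //.
rewrite -[1 in X in _ --> X]invr1; apply: cvgV; first exact: oner_neq0.
by rewrite -[1 in X in _ --> X]subr0; apply: cvgB => //; exact: cvg_cst.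
Qed.

Lemma has_density_not_dvdp (h : {poly F}) : h != 0 ->
  has_density (not_dvdp_pairs h) ((1 - q%:R ^- (size h).-1) ^+ 2 : R).
Proof.
move=> h0; apply: cvg_has_density; apply: cvg_near_cst.
exists (size h).-1 => // N /= le_hN.
rewrite card_npoly_pairs_not_dvdp // natrX -expr_div_n; congr (_ ^+ 2).
rewrite natrB ?leq_pexp2l ?leq_subr // !natrX expfB_cond ?(negbTE qR_neq0) //.
by rewrite mulrBl mulrAC divff ?mul1r // expf_neq0.
Qed.

Lemma has_density_logder_den_dvdp p : p \in [pchar F] ->
  has_density (@logder_den_dvdp_pairs F) (0 : R).
Proof.
move=> pcharFp.
have bound_cvg : (1 + q%:R) * q%:R ^- (N %/ 6) @[N --> \oo] --> (0 : R).
  have div6_cvg : (N %/ 6)%N @[N --> \oo] --> \oo by exact: cvg_divnr.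
  have pow_cvg : (q%:R ^- (N %/ 6) : R) @[N --> \oo] --> (0 : R).
    exact: cvg_comp div6_cvg cvg_qVn.
  rewrite -[0 in X in _ --> X](mulr0 (1 + q%:R)).
  by apply: cvgM pow_cvg; exact: cvg_cst.
apply: cvg_has_density; apply: squeeze_cvgr (cvg_cst 0) bound_cvg.
apply: nearW => N.
rewrite divr_ge0 ?ler0n ?exprn_ge0 //= ler_pdivrMr ?exprn_gt0 ?ltr0n //.
set D := (N %/ 6)%N; have DN : (D <= N)%N by exact: leq_div.
have -> : (1 + q%:R) * q%:R ^- D * (q%:R ^+ N) ^+ 2 =
    (q ^ N * (q ^ (N - D).+1 + q ^ (N - D)))%:R :> R.
  rewrite natrM natrD expnS natrM !natrX expfB_cond ?(negbTE qR_neq0) //.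
  by ring.
rewrite ler_nat (leq_trans (card_npoly_pairs_logder_den N D pcharFp)) //.
rewrite -mulnDr leq_mul2l leq_add2r -expnD leq_pexp2l ?orbT //.
have : (N %/ p <= N %/ 2)%N.
  by rewrite leq_div2l // prime_gt1 // (pcharf_prime pcharFp).
by rewrite /D; lia.
Qed.

End Densities.

Theorem theorem4p6 (R : realType) (q p : nat) (F : finFieldType)
  (hq4 : (4 <= q)%N) (hq : #|F| = q) (hp : p \in [pchar F]) :
  has_density (S2 F p) ((1 - q%:R^-1) ^+ 2 : R).
Proof.
apply: (has_density_diff_null (@S2_sub_not_dvdp_pairs F p)).
- exact: not_dvdp_pairs_sub hp.
- have := has_density_not_dvdp (R := R) (negbT (polyX_eq0 F)).
  by rewrite size_polyX expr1 hq.
- exact: has_density_logder_den_dvdp hp.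
Qed.
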